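(* For all $n\geqslant 2$, the function $\mathrm{nmaj}\in F(S^B_n)$ is induced by $\mathrm{maj}\in F(S_n)$.
   Context: For a finite Coxeter system $(W,S)$ with length $\ell$ and identity $e$, $F(W)$ is the set of functions $W\to\mathbb{Z}$, and $[\ell]$ is the set of $f\in F(W)$ that are equidistributed with $\ell$ (i.e. $\sum_{w\in W}q^{f(w)}=\sum_{w\in W}q^{\ell(w)}$) and satisfy $f(e)=0$ and $f(w_0)=\ell(w_0)$, where $w_0$ is the element of maximal length. For $J\subseteq S$, $W_J$ is the subgroup generated by $J$, $W^J=\{w\in W:\ell(ws)>\ell(w)\ \forall s\in J\}$, $\ell_J$ is the length of $(W_J,J)$ (the restriction of $\ell$), and each $w\in W$ factors uniquely as $w=w^Jw_J$ with $w^J\in W^J$, $w_J\in W_J$, $\ell(w)=\ell(w^J)+\ell(w_J)$. A function $f\in[\ell]$ is induced by $g\in F(W_J)$ if $g\in[\ell_J]$ and $f(w)=\ell(w^J)+g(w_J)$ for all $w\in W$. $S_n^B$ is the group of bijections $w$ of $[\pm n]=\{-n,\dots,-1,1,\dots,n\}$ with $w(-a)=-w(a)$, written as sequences $(w(1),\dots,w(n))$; it is a Coxeter group with generators $s_0=(-1,2,\dots,n)$ and $s_i=(1,\dots,i-1,i+1,i,i+2,\dots,n)$ for $1\le i\le n-1$, with length $\ell_B$. Here $J=\{s_1,\dots,s_{n-1}\}$, and $S_n$ is identified with the parabolic subgroup generated by $J$. For a sequence $\sigma=(\sigma(1),\dots,\sigma(n))$ of integers, $\mathrm{maj}(\sigma)=\sum_{i\in[n-1],\,\sigma(i)>\sigma(i+1)}i$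 and $\mathrm{Neg}(\sigma)=\{i\in[n]:\sigma(i)<0\}$. The negative major index is $\mathrm{nmaj}(\sigma)=\mathrm{maj}(\sigma)-\sum_{i\in\mathrm{Neg}(\sigma)}\sigma(i)$ for $\sigma\in S_n^B$. *)

(* Defs.v *)
From HB Require Import structures.
From mathcomp Require Import all_boot all_order all_algebra all_fingroup.
Set Implicit Arguments.
Unset Strict Implicit.
Unset Printing Implicit Defensive.
Import GRing.Theory.
Local Open Scope ring_scope.

Section Coxeter.

(* F(W), for a subgroup W of gT, is represented by functions gT -> int, of    *)
(* which only the values on W are ever used.                                  *)
Variable gT : finGroupType.
Implicit Types (W S J : {set gT}) (w : gT) (f g : gT -> int).

(* S ^+ k is the set of products of k elements of S; the bound k < #|gT| is   *)
(* harmless by coxlenP.                                                       *)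
Definition coxlen S w : nat :=
  \big[minn/#|gT|]_(k < #|gT| | w \in (S ^+ k)%g) k.

(* f may take negative values, so this is a Laurent polynomial in q = 'X; it  *)
(* is read in the fraction field of Z[q].                                     *)
Definition distribution W f : {fraction {poly int}} :=
  \sum_(w in W) tofrac 'X ^ f w.

Definition longest W S w : Prop :=
  w \in W /\ forall v, v \in W -> (coxlen S v <= coxlen S w)%N.

(* The set [\ell] for the system (W, S).                                      *)
Definition length_class W S f : Prop :=
  [/\ distribution W f = distribution W (fun w => (coxlen S w)%:Z),
      f 1%g = 0
    & forall w0, longest W S w0 -> f w0 = (coxlen S w0)%:Z].

(* W^J *)
Definition min_coset_reps W S J : {set gT} :=
  [set w in W | [forall s in J, (coxlen S w < coxlen S (w * s)%g)%N]].

(* The factors w^J and w_J of w; the pick is unique because the factorization *)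
(* is.                                                                        *)
Definition upper_part W S J w : gT :=
  odflt 1%g [pick u in min_coset_reps W S J | (u^-1 * w)%g \in <<J>>%g].
Definition lower_part W S J w : gT := ((upper_part W S J w)^-1 * w)%g.

Definition induced_by W S J f g : Prop :=
  [/\ length_class W S f, length_class <<J>>%g J g
    & forall w, w \in W ->
        f w = (coxlen S (upper_part W S J w))%:Z + g (lower_part W S J w)].

Lemma coxlenP S w : w \in <<S>>%g ->
  w \in (S ^+ coxlen S w)%g /\
  forall k, w \in (S ^+ k)%g -> (coxlen S w <= k)%N.
Proof.
move=> wS; have Sn : exists n, w \in (S ^+ n)%g.
  case/gen_prodgP: wS => n [c cS ->]; exists n.
  have -> : (S ^+ n)%g = (\prod_(i < n) S)%g by rewrite big_const_ord /natexp Monoid.iteropE.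
  by apply: mem_prodg => i _; apply: cS.
case: (ex_minnP Sn) => k Sk mink.
pose exact j y := (y \in (S ^+ j)%g) && [forall i : 'I_j, y \notin (S ^+ i)%g].
have exact_lt i j y : exact i y -> exact j y -> ~~ (i < j)%N.
  case/andP=> yi _ /andP[_ /forallP yj]; apply/negP => ij.
  by have := yj (Ordinal ij); rewrite yi.
have pre d : (d <= k)%N -> exists y, exact (k - d)%N y.
  elim: d => [_ | d IHd dk].
    exists w; rewrite subn0 /exact Sk; apply/forallP=> i; apply/negP => /mink.
    by rewrite leqNgt ltn_ord.
  have [y] := IHd (ltnW dk); rewrite -(subnSK dk) => /andP[].
  rewrite expgSr => /mulsgP[z s zS sS ->] /forallP yj.
  exists z; rewrite /exact zS; apply/forallP => i; apply/negP => zi.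
  have := yj (lift ord0 i); rewrite /= /bump /= add1n expgSr.
  by rewrite mem_mulg.
have pre' (j : 'I_k.+1) : exists y, exact j y.
  by have := pre _ (leq_subr j k); rewrite subKn // -ltnS.
have [h hP] := fin_all_exists pre'.
have kG : (k < #|gT|)%N.
  have inj_h : injective h.
    move=> i j hij; have hi := hP i; have hj := hP j; rewrite hij in hi.
    have := exact_lt _ _ _ hi hj; have := exact_lt _ _ _ hj hi.
    rewrite -!leqNgt => ij ji; apply: val_inj => /=; apply/eqP.
    by rewrite eqn_leq ij ji.
  by have := leq_card h inj_h; rewrite card_ord.
suff -> : coxlen S w = k by [].
apply/eqP; rewrite eqn_leq; apply/andP; split.
  have := mem_index_enum (Ordinal kG); rewrite /coxlen.
  elim: (index_enum _) => // i r IHr; rewrite inE big_cons.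
  case/predU1P => [<- | /IHr le_k]; first by rewrite /= Sk geq_minl.
  by case: ifP => // _; rewrite geq_min le_k orbT.
rewrite /coxlen; elim/big_ind: _ => [|a b ka kb|i /mink //]; first exact: ltnW.
by rewrite leq_min ka.
Qed.

End Coxeter.

Section SignedPermutations.

Variable n : nat.

(* (b, i) is the element i + 1 of [\pm n] if b = false, -(i + 1) if b = true. *)
Definition pmI := (bool * 'I_n)%type.
Definition pm_val (a : pmI) : int := (-1) ^+ a.1 * (a.2.+1)%:Z.
Definition pm_opp (a : pmI) : pmI := (~~ a.1, a.2).

Lemma pm_val_opp a : pm_val (pm_opp a) = - pm_val a.
Proof. by rewrite /pm_val signrN mulNr. Qed.

Definition odd_pm (w : {perm pmI}) := [forall a, w (pm_opp a) == pm_opp (w a)].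

(* This is a new type, not a subgroup of {perm pmI}, because the product of   *)
(* {perm _} applies its left factor first; the product here is composition of *)
(* functions (spermM). With the other order, the cosets of W_J would be on    *)
(* the wrong side.                                                            *)
Record sperm := SPerm { sperm_val :> {perm pmI}; _ : odd_pm sperm_val }.

HB.instance Definition _ := [isSub for sperm_val].
HB.instance Definition _ := [Finite of sperm by <:].

Lemma spermN (w : sperm) a : w (pm_opp a) = pm_opp (w a).
Proof. by case: w => w /= /forallP/(_ a)/eqP. Qed.

Lemma sperm_one_subproof : odd_pm 1%g.
Proof. by apply/forallP => a; rewrite !perm1. Qed.

Lemma sperm_mul_subproof (u v : sperm) : odd_pm (sperm_val v * sperm_val u)%g.
Proof. by apply/forallP => a; rewrite !permM !spermN. Qed.

Lemma sperm_inv_subproof (u : sperm) : odd_pm (sperm_val u)^-1%g.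
Proof.
by apply/forallP => a; apply/eqP/(@perm_inj _ u); rewrite spermN !permKV.
Qed.

Definition sperm_one := SPerm sperm_one_subproof.
Definition sperm_mul u v := SPerm (sperm_mul_subproof u v).
Definition sperm_inv u := SPerm (sperm_inv_subproof u).

Lemma sperm_mulA : associative sperm_mul.
Proof. by move=> u v w; apply: val_inj; rewrite /= mulgA. Qed.

Lemma sperm_mul1 : left_id sperm_one sperm_mul.
Proof. by move=> u; apply: val_inj; rewrite /= mulg1. Qed.

Lemma sperm_mulV : left_inverse sperm_one sperm_inv sperm_mul.
Proof. by move=> u; apply: val_inj; rewrite /= mulgV. Qed.

HB.instance Definition _ := Finite_isGroup.Build sperm
  sperm_mulA sperm_mul1 sperm_mulV.

Lemma spermM (u v : sperm) a : (u * v)%g a = u (v a).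
Proof. by rewrite /= permM. Qed.

Lemma flip_subproof (i : 'I_n) : odd_pm (tperm (false, i) (true, i)).
Proof.
apply/forallP => -[b j]; rewrite /pm_opp /=.
by case: (eqVneq i j) => [<-|ij]; case: b; rewrite /= ?tpermL ?tpermR // !tpermD //;
  rewrite xpair_eqE (negPf ij) andbF.
Qed.

Definition flip (i : 'I_n) : sperm := SPerm (flip_subproof i).

Lemma sperm_of_inj (s : 'S_n) : injective (fun a : pmI => (a.1, s a.2)).
Proof. by move=> [b i] [c j] [-> /perm_inj ->]. Qed.

Lemma sperm_of_subproof (s : 'S_n) : odd_pm (perm (@sperm_of_inj s)).
Proof. by apply/forallP => a; rewrite !permE. Qed.

Definition sperm_of (s : 'S_n) : sperm := SPerm (sperm_of_subproof s).

(* J = {s_1, ..., s_(n-1)}; positions are numbered from 0 here.               *)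
Definition gensA : {set sperm} :=
  [set sperm_of (tperm i j) | i in 'I_n, j in 'I_n & val j == (val i).+1].

(* {s_0, s_1, ..., s_(n-1)} *)
Definition gensB : {set sperm} :=
  [set flip i | i in 'I_n & val i == 0%N] :|: gensA.

(* The sequence (w(1), ..., w(n)). *)
Definition window (w : sperm) : seq int :=
  [seq pm_val (w (false, i)) | i <- enum 'I_n].

End SignedPermutations.

(* Sequences are indexed from 1 in the sums: sigma(i) is s`_i.-1.             *)
Definition seq_maj (s : seq int) : nat :=
  (\sum_(1 <= i < size s | (s`_i < s`_i.-1)%R) i)%N.

Definition seq_nmaj (s : seq int) : int :=
  (seq_maj s)%:Z - \sum_(1 <= i < (size s).+1 | s`_i.-1 < 0) s`_i.-1.

(* On W_J = S_n, maj is the major index of the permutation.                   *)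
Definition maj n (w : sperm n) : int := (seq_maj (window w))%:Z.
Definition nmaj n (w : sperm n) : int := seq_nmaj (window w).

(* Main.v *)
Require Import Defs.
From mathcomp Require Import all_boot all_order all_algebra all_fingroup.
From mathcomp Require Import zify.
Set Implicit Arguments.
Unset Strict Implicit.
Unset Printing Implicit Defensive.
Import Order.TTheory GRing.Theory Num.Theory.

(** Write v_i for the signed value w(i), inv for the number of inversions of
    the window of w, and neg for the sum of the absolute values of its negative
    entries.

    Everything rests on the formula lengthB = inv + neg for the length. To
    prove it, it is enough that this quantity vanishes at the identity, grows
    by at most 1 under right multiplication by a generator, and can be lowered
    by some generator at every other element (coxlen_descent). Exchanging two
    adjacent positions changes inv by 1 and fixes neg. Changing the sign of
    v_1 = k > 0 adds k to neg and removes the k - 1 inversions formed by v_1 and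
    the entries of smaller absolute value. The same formula, with neg = 0,
    gives the length of the parabolic subgroup of unsigned permutations.

    In the factorization w = u p with p in W_J, minimality of u makes the window
    of u increasing. Thus the window of w is that of p relabelled monotonically:
    w and p have the same inversions and the same descents, while neg only sees
    u, whose length is neg because it has no inversion. Hence
    nmaj w = neg + maj p = length u + maj p, and length w = length u + length p
    (parabolic_factorization).

    Equidistribution of maj and inv on S_n (macmahon) follows by induction
    on n, adding a last letter. Summing over each left coset of W_J separately
    then transfers it to nmaj and the length (eq_distribution_cosets). Finally
    the longest element has a decreasing window, where every position is a
    descent and every pair an inversion, so that both statistics agree. *)

(** * Inversion and descent statistics *)

(** Inversions and the major index are both sums of weights of the pairs i < j
    with v j < v i: all pairs with weight 1 for the former, the adjacent ones
    with weight j for the latter. Positions being numbered from 0 here, a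
    descent between i and i + 1 has weight i + 1. *)
Definition weighted_inv (R : rel nat) (c : nat -> nat) n (v : 'I_n -> int) : nat :=
  \sum_(j < n) \sum_(i < n | R i j) (v j < v i)%R * c j.
Definition inversions n (v : 'I_n -> int) := weighted_inv ltn (fun=> 1) v.
Definition major_index n (v : 'I_n -> int) := weighted_inv (fun i j => i.+1 == j) id v.

Lemma eq_weighted_inv R c n (v v' : 'I_n -> int) :
  (forall i j, (v j < v i)%R = (v' j < v' i)%R) ->
  weighted_inv R c v = weighted_inv R c v'.
Proof. by move=> E; do 2!apply: eq_bigr => ? _; rewrite E. Qed.

Lemma seq_maj_map_enum n (v : 'I_n -> int) :
  seq_maj [seq v i | i <- enum 'I_n] = major_index v.
Proof.
have nthv (i : 'I_n) : (nth 0%R [seq v i | i <- enum 'I_n] i) = v i.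
  by rewrite (nth_map i) ?nth_ord_enum // size_enum_ord.
rewrite /seq_maj /major_index /weighted_inv size_map size_enum_ord.
case: n v nthv => [|n] v nthv; first by rewrite big_geq // big_ord0.
rewrite [RHS]big_ord_recl [X in _ = X + _]big1 // add0n big_add1 /= big_mkord big_mkcond /=.
apply: eq_bigr => j _.
rewrite (big_pred1 (widen_ord (leqnSn n) j)) => [|i]; last first.
  by rewrite /= /bump /= add1n eqSS -val_eqE.
have := nthv (lift ord0 j); have := nthv (widen_ord (leqnSn n) j).
rewrite /= /bump /= !add1n => -> ->.
by case: ifP; rewrite ?mul1n ?mul0n.
Qed.

(** For a decreasing sequence, position j contributes j to both sums: as the j
    pairs (i, j) with i < j, and as the weight of the descent ending at j. *)
Lemma decreasing_major_index n (v : 'I_n -> int) :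
  (forall i j : 'I_n, i < j -> (v j < v i)%R) -> major_index v = inversions v.
Proof.
move=> dec; apply: eq_bigr => j _.
transitivity (val j).
  case: j => [[|j] jn] /=; first by rewrite big1.
  rewrite (big_pred1 (Ordinal (ltnW jn))) => [|i]; last by rewrite /= eqSS -val_eqE.
  by rewrite dec //= mul1n.
rewrite -[LHS]card_ord -sum1_card (big_ord_widen n (fun=> 1)); last exact: ltnW (ltn_ord j).
by apply: eq_bigr => i ij; rewrite dec.
Qed.

(** Appending a last letter k to s, after raising by 1 the letters that are at
    least k, keeps the relative order of the other letters; the only new pairs
    are those formed with the last position. *)
Lemma weighted_inv_lift_perm (R : rel nat) c n k (s : 'S_n) :
  (forall i j, R i j -> i < j) ->
  weighted_inv R c (fun i => (lift_perm ord_max k s i)%:Z)%R =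
    weighted_inv R c (fun i => (s i)%:Z)%R + (\sum_(i < n | R i n) (k <= s i)) * c n.
Proof.
move=> Rlt.
have Rmax j : j <= n -> R n j = false.
  by move=> jn; apply/negP => /Rlt; rewrite ltnNge jn.
have wid (i : 'I_n) : widen_ord (leqnSn n) i = lift ord_max i.
  by apply: val_inj; rewrite /= /bump leqNgt ltn_ord.
rewrite /weighted_inv big_ord_recr /=; congr (_ + _).
  apply: eq_bigr => j _; rewrite big_mkcond big_ord_recr /= Rmax 1?ltnW // addn0.
  rewrite [RHS]big_mkcond; apply: eq_bigr => i _; rewrite !wid !lift_perm_lift.
  by rewrite !ltz_nat /= /bump; case: ifP => // _; congr (nat_of_bool _ * _); lia.
rewrite big_mkcond big_ord_recr /= Rmax // addn0 big_distrl /= [RHS]big_mkcond.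
apply: eq_bigr => i _; rewrite wid lift_perm_lift lift_perm_id.
by rewrite !ltz_nat /= /bump; case: ifP => // _; congr (nat_of_bool _ * _); lia.
Qed.

Lemma lift_perm_bij n :
  bijective (fun p : 'I_n.+1 * 'S_n => lift_perm ord_max p.1 p.2).
Proof.
apply: inj_card_bij => [[k s] [l t] /= E|]; last first.
  by rewrite card_prod !card_Sn card_ord factS.
have kl : k = l by rewrite -(lift_perm_id ord_max k s) E lift_perm_id.
subst l; congr (_, _); apply/permP => i; apply: (@lift_inj _ k).
by rewrite -!(lift_perm_lift ord_max) E.
Qed.

(** * Equidistribution of the major index and inversions *)

Section MacMahon.
Variables (R : comNzRingType) (q : R).
Local Open Scope ring_scope.

Lemma big_lift_perm n (F : 'S_n.+1 -> R) :
  \sum_(s : 'S_n.+1) F s = \sum_k \sum_(s : 'S_n) F (lift_perm ord_max k s).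
Proof.
by rewrite pair_bigA (reindex _ (onW_bij _ (lift_perm_bij n))).
Qed.

Local Notation pinv s := (inversions (fun i => (s i)%:Z)).
Local Notation pmaj s := (major_index (fun i => (s i)%:Z)).

Lemma inversions_lift_perm n k (s : 'S_n) :
  pinv (lift_perm ord_max k s) = (pinv s + (n - k))%N.
Proof.
rewrite /inversions weighted_inv_lift_perm // muln1; congr addn.
rewrite (eq_bigl xpredT) => [|i]; last exact: ltn_ord.
transitivity (\sum_(i < n) (k <= i))%N;
  first by rewrite [RHS](reindex_inj (@perm_inj _ s)).
rewrite -(big_mkord xpredT (fun i => nat_of_bool (k <= i)%N))
  (big_cat_nat (n := k)) //=;
  last by rewrite -ltnS.
rewrite big_nat_cond big1 => [|i]; last by rewrite andbT => /= ik; rewrite leqNgt ik.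
rewrite add0n (eq_big_nat _ _ (F2 := fun=> 1%N)) => [|i /andP[-> //]].
by rewrite sum_nat_const_nat muln1.
Qed.

Lemma maj_lift_perm n k (s : 'S_n.+1) :
  pmaj (lift_perm ord_max k s) = (pmaj s + (k <= s ord_max) * n.+1)%N.
Proof.
rewrite /major_index weighted_inv_lift_perm => [|i _ /eqP<- //].
by rewrite (big_pred1 ord_max) // => i; rewrite /= eqSS -val_eqE.
Qed.

(** Both sides are the sum of q ^+ e over the interval of the m + 1 exponents e
    from m + 1 - k to 2 m + 1 - k; the terms correspond under rotation by k. *)
Lemma sum_cyclic_shift m k : (k <= m.+1)%N ->
  \sum_(j < m.+1) q ^+ ((k <= j) * m.+1 + (m - j)) =
  \sum_(j < m.+1) q ^+ (m.+1 - k + (m - j)).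
Proof.
move=> km; rewrite [RHS](reindex_inj (addIr (inZp (m.+1 - k)))) /=.
apply: eq_bigr => j _; congr (q ^+ _); rewrite modnDmr.
have jm := ltn_ord j; case: leqP => kj.
  have -> : (j + (m.+1 - k) = j - k + m.+1)%N by lia.
  by rewrite modnDr modn_small; lia.
by rewrite modn_small; lia.
Qed.

(** The last letter k shifts the distribution of maj by n - k, as it shifts inv
    for each single permutation. For maj this holds only after summation. Split
    the sum by the last letter j of s: by induction on n, letter j contributes
    q ^+ (n.-1 - j) times a factor common to all j, and k adds n to maj if
    k <= j, which amounts to a cyclic shift of the exponents. *)
Lemma sum_maj_lift_perm n (k : 'I_n.+1) :
  \sum_(s : 'S_n) q ^+ pmaj (lift_perm ord_max k s) =
  q ^+ (n - k) * \sum_(s : 'S_n) q ^+ pmaj s.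
Proof.
elim: n k => [|n IHn] k.
  rewrite sub0n mul1r; apply: eq_bigr => s _.
  by rewrite /major_index weighted_inv_lift_perm ?muln0 ?addn0 // => i _ /eqP<-.
rewrite (eq_bigr (fun s : 'S_n.+1 => q ^+ pmaj s * q ^+ ((k <= s ord_max) * n.+1)));
  last first.
  by move=> s _; rewrite maj_lift_perm exprD.
rewrite !big_lift_perm.
rewrite [in RHS](eq_bigr _ (fun j _ => IHn j)) mulr_sumr.
transitivity ((\sum_(j < n.+1) q ^+ ((k <= j) * n.+1 + (n - j))) *
              \sum_(s : 'S_n) q ^+ pmaj s).
  rewrite mulr_suml; apply: eq_bigr => j _; rewrite exprD -mulrA -IHn mulr_sumr.
  by apply: eq_bigr => s _; rewrite lift_perm_id mulrC.
rewrite sum_cyclic_shift; last by rewrite -ltnS.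
by rewrite mulr_suml; apply: eq_bigr => j _; rewrite exprD mulrA.
Qed.

Lemma macmahon n : \sum_(s : 'S_n) q ^+ pmaj s = \sum_(s : 'S_n) q ^+ pinv s.
Proof.
elim: n => [|n IHn].
  by apply: eq_bigr => s _; rewrite /major_index /inversions /weighted_inv !big_ord0.
rewrite !big_lift_perm; apply: eq_bigr => k _.
rewrite sum_maj_lift_perm IHn mulr_sumr; apply: eq_bigr => s _.
by rewrite inversions_lift_perm exprD mulrC.
Qed.

End MacMahon.

(** * Lengths and parabolic factorizations in finite groups *)

Section CoxeterLength.
Variable gT : finGroupType.
Implicit Types (W G : {group gT}) (S J : {set gT}).
Local Open Scope group_scope.

(** A function that generators raise by at most 1 bounds the length from below;
    if some generator lowers it at each w <> 1, then descending along such
    generators writes w as a product of at most L w of them. The descent also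
    shows that S generates G. *)
Lemma coxlen_descent G S (L : gT -> nat) :
    S \subset G -> L 1 = 0%N ->
    (forall w s, w \in G -> s \in S -> L (w * s) <= (L w).+1) ->
    (forall w, w \in G -> w != 1 -> exists2 s, s \in S & L (w * s^-1) < L w) ->
  <<S>> = G /\ {in G, coxlen S =1 L}.
Proof.
move=> sSG L1 L_step L_desc.
have reach w : w \in G -> exists2 k, k <= L w & w \in S ^+ k.
  have [m] := ubnP (L w); elim: m w => // m IHm w Lwm Gw.
  have [->|w1] := eqVneq w 1; first by exists 0%N; rewrite ?expg0 ?set11.
  have [s Ss Lws] := L_desc w Gw w1.
  have [||k kL Sk] := IHm (w * s^-1).
  - exact: leq_trans Lws _.
  - by rewrite groupM // groupV (subsetP sSG).
  exists k.+1; first exact: leq_ltn_trans kL Lws.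
  by rewrite -(mulgKV s w) expgSr mem_mulg.
have genG : <<S>> = G.
  apply/eqP; rewrite eqEsubset gen_subG sSG; apply/subsetP => w /reach[k _].
  by apply: subsetP; elim: k => [|k IHk]; rewrite ?expg0 ?sub1G // expgSr mul_subG ?subset_gen.
split=> // w Gw; have [|Sl min_l] := @coxlenP _ S w; first by rewrite genG.
have [k kL Sk] := reach w Gw.
apply/eqP; rewrite eqn_leq (leq_trans (min_l k Sk) kL) /=.
suff L_le m x : x \in S ^+ m -> (x \in G) && (L x <= m) by have /andP[] := L_le _ _ Sl.
elim: m x => [|m IHm] x; first by rewrite expg0 => /set1P->; rewrite group1 L1.
rewrite expgSr => /mulsgP[y s /IHm /andP[Gy Ly] Ss ->].
rewrite groupM ?(subsetP sSG s) //=.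
exact: leq_trans (L_step _ _ Gy Ss) _.
Qed.

(** An element of minimal length in the coset w <<J>> is a minimal coset
    representative, so the choice that defines upper_part succeeds. *)
Lemma factorizationP W S J :
    J \subset W ->
    (forall u s, u \in W -> s \in J -> coxlen S (u * s) != coxlen S u) ->
  forall w, w \in W ->
    upper_part W S J w \in min_coset_reps W S J /\ lower_part W S J w \in <<J>>.
Proof.
move=> sJW neq_len w Ww; rewrite /lower_part /upper_part.
case: pickP => [u /andP[] // | no_rep].
pose P u := (u \in W) && (u^-1 * w \in <<J>>).
have Pw : P w by rewrite /P Ww mulVg group1.
case: (arg_minnP (coxlen S) Pw) => u /andP[Wu Ju] min_u.
have /negP[] := no_rep u; rewrite Ju andbT inE Wu /=; apply/forall_inP => s Js.
rewrite ltn_neqAle eq_sym neq_len //= min_u // /P groupM ?(subsetP sJW s) //=.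
by rewrite invMg -mulgA groupM // groupV mem_gen.
Qed.

Lemma upper_partM W S J w p :
  p \in <<J>> -> upper_part W S J (w * p) = upper_part W S J w.
Proof.
move=> Jp; congr odflt; apply: eq_pick => u.
by rewrite mulgA groupMr.
Qed.

(** The fibres of upper_part are left cosets of <<J>>, on each of which the first
    term is constant, whence a factor q ^ a u times the distribution of the
    second term on <<J>>. *)
Lemma eq_distribution_cosets W S J (a f f' g g' : gT -> int) :
    J \subset W ->
    (forall w, w \in W -> lower_part W S J w \in <<J>>) ->
    (forall w, w \in W -> f w = a (upper_part W S J w) + g (lower_part W S J w))%R ->
    (forall w, w \in W -> f' w = a (upper_part W S J w) + g' (lower_part W S J w))%R ->
    distribution <<J>> g = distribution <<J>> g' ->
  distribution W f = distribution W f'.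
Proof.
move=> sJW lowJ fE f'E eq_gg'; rewrite /distribution.
have q_neq0 : (tofrac 'X : {fraction {poly int}})%R != 0%R.
  by rewrite tofrac_eq0 polyX_eq0.
rewrite [LHS](partition_big (upper_part W S J) predT) //=.
rewrite [RHS](partition_big (upper_part W S J) predT) //=; apply: eq_bigr => u _.
have [w0 /andP[Ww0 /eqP u_w0]|none] :=
  pickP [pred w in W | upper_part W S J w == u]; last first.
  by rewrite !big_pred0.
have Ju : u^-1 * w0 \in <<J>> by have := lowJ w0 Ww0; rewrite /lower_part u_w0.
have sub : <<J>> \subset W by rewrite gen_subG.
have fib p : (u * p \in W) && (upper_part W S J (u * p) == u) = (p \in <<J>>).
  have Wu : u \in W by rewrite -(groupMr u (subsetP sub _ Ju)) mulKVg.
  apply/andP/idP => [[Wup /eqP uE] | Jp].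
    by have := lowJ _ Wup; rewrite /lower_part uE mulKg.
  split; first by rewrite groupM // (subsetP sub).
  have -> : u * p = w0 * ((u^-1 * w0)^-1 * p) by rewrite invMg invgK -mulgA mulKVg.
  by rewrite upper_partM ?u_w0 // groupM // groupV.
have fiber h k :
    (forall w, w \in W ->
       h w = a (upper_part W S J w) + k (lower_part W S J w))%R ->
    (\sum_(w in W | upper_part W S J w == u) tofrac 'X ^ h w =
     tofrac 'X ^ a u * distribution <<J>> k :> {fraction {poly int}})%R.
  move=> hE; rewrite (reindex_inj (mulgI u)) mulr_sumr.
  apply: eq_big => // p /andP[Wup /eqP uE].
  by rewrite hE // /lower_part uE mulKg expfzDr.
by rewrite (fiber _ _ fE) (fiber _ _ f'E) eq_gg'.
Qed.

End CoxeterLength.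

(** * Adjacent exchanges and monotone sequences *)

Lemma inversions_pair n (v : 'I_n -> int) :
  inversions v = \sum_(p : 'I_n * 'I_n | p.2 < p.1) (v p.1 < v p.2)%R.
Proof.
rewrite /inversions /weighted_inv pair_big_dep; apply: eq_bigr => p _; exact: muln1.
Qed.

(** The exchange of the adjacent positions i and j preserves the order of every
    pair of positions other than (i, j), so only this pair can become an
    inversion. *)
Lemma inversions_tperm n (v : 'I_n -> int) (i j : 'I_n) :
  j = i.+1 :> nat -> (v i < v j)%R -> inversions (v \o tperm i j) = (inversions v).+1.
Proof.
move=> ji vij; rewrite !inversions_pair.
have [t tE] : {t | t = tperm i j} by exists (tperm i j).
rewrite -tE (reindex_inj (h := fun p => (t p.1, t p.2))) /=; last first.
  by move=> [a b] [c d] [/perm_inj-> /perm_inj->].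
rewrite [LHS](bigD1 (i, j)); last by rewrite /= tE tpermL tpermR ji.
rewrite [in RHS](bigD1 (j, i)) /=; last by rewrite ji.
have tt x : t (t x) = x by rewrite tE tpermK.
rewrite !tt vij [(v j < v i)%R]ltNge (ltW vij) add0n add1n; congr _.+1.
apply: eq_big => [[a b] | [a b] _] /=; last by rewrite !tt.
rewrite !xpair_eqE tE.
by case: (tpermP i j a) => [->|->|/eqP+ /eqP+];
  case: (tpermP i j b) => [->|->|/eqP+ /eqP+];
  rewrite -?val_eqE /=; lia.
Qed.

Lemma inversions_recl n (v : 'I_n.+1 -> int) :
  inversions v = \sum_(j < n) (v (lift ord0 j) < v ord0)%R + inversions (v \o lift ord0).
Proof.
rewrite /inversions /weighted_inv big_ord_recl big1 // add0n -big_split /=.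
apply: eq_bigr => j _; rewrite big_mkcond big_ord_recl /= muln1; congr addn.
by rewrite -big_mkcond.
Qed.

Lemma adjacent_increasing n (v : 'I_n -> int) :
  (forall i j : 'I_n, j = i.+1 :> nat -> (v i < v j)%R) ->
  forall i j : 'I_n, i < j -> (v i < v j)%R.
Proof.
move=> adj i [k kn]; elim: k kn => // k IHk kn /=; rewrite ltnS leq_eqVlt.
case/predU1P => [ik | ik]; first by apply: adj; rewrite /= ik.
by apply: lt_trans (IHk (ltnW kn) ik) _; apply: adj.
Qed.

Lemma increasing_weighted_inv (R : rel nat) c n (v : 'I_n -> int) :
  (forall i j, R i j -> i < j) ->
  (forall i j : 'I_n, i < j -> (v i < v j)%R) -> weighted_inv R c v = 0.
Proof.
move=> Rlt inc; apply: big1 => j _; apply: big1 => i /Rlt ij.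
by rewrite ltNge ltW ?inc.
Qed.

(** An increasing permutation satisfies i <= s i, and so does its inverse. *)
Lemma increasing_perm1 n (s : 'S_n) : (forall i j : 'I_n, i < j -> s i < s j) -> s = 1%g.
Proof.
have ge_id (t : 'S_n) : (forall i j : 'I_n, i < j -> t i < t j) -> forall i : 'I_n, i <= t i.
  move=> inc [k kn] /=; elim: k kn => // k IHk kn.
  exact: leq_ltn_trans (IHk (ltnW kn)) (inc (Ordinal (ltnW kn)) (Ordinal kn) _).
move=> inc; apply/permP => i; rewrite perm1; apply/val_inj/eqP.
rewrite eqn_leq ge_id // andbT -[X in _ <= nat_of_ord X](permK s) ge_id // => a b ab.
rewrite ltnNge; apply/negP; rewrite leq_eqVlt => /predU1P[/val_inj/perm_inj E|/inc].
  by rewrite E ltnn in ab.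
by rewrite !permKV ltnNge ltnW.
Qed.

(** * The length of signed permutations *)

Definition negsum n (v : 'I_n -> int) := \sum_i if (v i < 0)%R then `|v i|%N else 0.

Section SignedPerm.
Variable n : nat.
Implicit Types (w u : sperm n) (s : 'S_n).

Definition value w i : int := pm_val (w (false, i)).
Definition lengthB w := inversions (value w) + negsum (value w).

Lemma abs_inj w : injective (fun i => (w (false, i)).2).
Proof.
move=> i j E; have : w (false, i) = w (false, j) \/ w (false, i) = w (pm_opp (false, j)).
  rewrite spermN; move: E; case: (w _) => [b x]; case: (w _) => [c y] /= ->.
  by case: b; case: c; [left|right|right|left].
by case=> /perm_inj [].
Qed.
Definition abs_perm w : 'S_n := perm (@abs_inj w).

Lemma absz_value w i : `|value w i|%N = (abs_perm w i).+1.
Proof. by rewrite /value /pm_val permE abszMsign. Qed.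

Lemma sperm_ext w u : (forall i, w (false, i) = u (false, i)) -> w = u.
Proof.
move=> E; apply/val_inj/permP => -[[] i] //=.
by have := spermN w (false, i); have := spermN u (false, i); rewrite /pm_opp /= E => -> ->.
Qed.

Lemma value_inj w u : value w =1 value u -> w = u.
Proof.
move=> E; apply: sperm_ext => i; have := E i; rewrite /value /pm_val.
case: (w _) => [b x]; case: (u _) => [c y] /= {}E.
have xy : x = y by apply: ord_inj; case: b c E => -[] /=; lia.
by subst y; congr (_, _); case: b c E => -[] /=; lia.
Qed.

Lemma value_sperm_of s i : value (sperm_of s) i = (s i).+1%:Z%R.
Proof. by rewrite /value /= permE /pm_val /= mul1r. Qed.

Lemma value1 i : value 1%g i = i.+1%:Z%R.
Proof. by rewrite /value /= perm1 /pm_val /= mul1r. Qed.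

Lemma valueM_sperm_of w s i : value (w * sperm_of s)%g i = value w (s i).
Proof. by rewrite /value spermM /= permE. Qed.

Lemma valueM_flip w k i :
  value (w * flip k)%g i = (if i == k then - value w i else value w i)%R.
Proof.
rewrite /value spermM /=; case: eqVneq => [-> | ik].
  by rewrite tpermL -[(true, k)]/(pm_opp (false, k)) spermN pm_val_opp.
by rewrite tpermD // xpair_eqE eq_sym (negPf ik).
Qed.

Lemma negsumM_sperm_of w s : negsum (value (w * sperm_of s)%g) = negsum (value w).
Proof.
rewrite /negsum [RHS](reindex_inj (@perm_inj _ s)).
by apply: eq_bigr => i _; rewrite valueM_sperm_of.
Qed.

Lemma negsum_sperm_of s : negsum (value (sperm_of s)) = 0.
Proof. by apply: big1 => i _; rewrite value_sperm_of. Qed.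

Lemma positive_increasing1 w :
  (forall i, 0 < value w i)%R -> (forall i j : 'I_n, i < j -> (value w i < value w j)%R) ->
  w = 1%g.
Proof.
move=> pos inc.
have valE i : value w i = (abs_perm w i).+1%:Z%R.
  by rewrite -absz_value gtz0_abs ?pos.
apply: value_inj => i; rewrite value1 valE.
rewrite (@increasing_perm1 _ (abs_perm w)) ?perm1 // => j k jk.
by have := inc j k jk; rewrite !valE ltz_nat ltnS.
Qed.

Lemma gensA_adjacent (i j : 'I_n) : j = i.+1 :> nat -> sperm_of (tperm i j) \in gensA n.
Proof.
move=> ji; apply/imset2P; apply: (Imset2spec (x1 := i) (x2 := j)) => //.
by rewrite inE; apply/andP; split=> //; apply/eqP.
Qed.

Lemma mem_gensA w : w \in gensA n ->
  exists i j : 'I_n, j = i.+1 :> nat /\ w = sperm_of (tperm i j).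
Proof. by case/imset2P => i j _; rewrite !inE => /eqP ji ->; exists i, j. Qed.

Lemma sperm_of_tpermK w i j : (w * sperm_of (tperm i j) * sperm_of (tperm i j) = w)%g.
Proof.
by apply: value_inj => k; rewrite !valueM_sperm_of tpermK.
Qed.

Lemma flipK w k : (w * flip k * flip k = w)%g.
Proof.
by apply: value_inj => i; rewrite !valueM_flip; case: eqP => // _; rewrite opprK.
Qed.

Lemma lengthB_adjacent w (i j : 'I_n) : j = i.+1 :> nat ->
  (value w i < value w j)%R -> lengthB (w * sperm_of (tperm i j))%g = (lengthB w).+1.
Proof.
move=> ji vij; rewrite /lengthB negsumM_sperm_of -addSn -(inversions_tperm ji vij); congr addn.
by apply: eq_weighted_inv => a b; rewrite !valueM_sperm_of.
Qed.

Lemma lengthB_adjacent_desc w (i j : 'I_n) : j = i.+1 :> nat ->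
  (value w j < value w i)%R -> (lengthB (w * sperm_of (tperm i j))%g).+1 = lengthB w.
Proof.
move=> ji vij; rewrite -[in RHS](sperm_of_tpermK w i j) [RHS](lengthB_adjacent ji) //.
by rewrite !valueM_sperm_of tpermL tpermR.
Qed.

Lemma value_neq w (i j : 'I_n) : i != j -> value w i != value w j.
Proof.
move=> /eqP ij; apply/eqP => E; apply: ij; apply: (@perm_inj _ (abs_perm w)).
by apply/ord_inj/succn_inj; rewrite -!absz_value E.
Qed.

Lemma adjacent_cases w (i j : 'I_n) : j = i.+1 :> nat ->
  (value w i < value w j)%R \/ (value w j < value w i)%R.
Proof.
move=> ji; case: ltgtP => [||/eqP]; [by left|by right|].
by rewrite (negPf (value_neq _ _)) // -val_eqE /= ji neq_ltn ltnSn.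
Qed.

End SignedPerm.

(** If v_0 = a + 1 > 0, making it negative adds a + 1 to negsum. The inversions
    lost are the pairs (0, j) with |v_j| <= a; there are a of them, because the
    absolute values are a permutation of 1, ..., n + 1. *)
Lemma lengthB_flip n (w : sperm n.+1) :
  (0 < value w ord0)%R -> lengthB (w * flip ord0)%g = (lengthB w).+1.
Proof.
move=> pos; rewrite /lengthB /negsum !inversions_recl !big_ord_recl !valueM_flip eqxx.
have -> : inversions (value (w * flip ord0)%g \o lift ord0) = inversions (value w \o lift ord0).
  by apply: eq_weighted_inv => i j; rewrite /= !valueM_flip.
rewrite [in LHS](eq_bigr (fun j => (value w (lift ord0 j) < - value w ord0)%R : nat)); last first.
  by move=> j _; rewrite valueM_flip.
rewrite [X in _ + (_ + X)](eq_bigr (fun i =>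
    if (value w (lift ord0 i) < 0)%R then `|value w (lift ord0 i)| else 0)); last first.
  by move=> j _; rewrite valueM_flip.
rewrite oppr_lt0 pos ltNge (ltW pos) /= abszN absz_value.
set a := abs_perm w ord0.
suff -> : \sum_(j < n) (value w (lift ord0 j) < value w ord0)%R =
          \sum_(j < n) (value w (lift ord0 j) < - value w ord0)%R + a
  by rewrite add0n addSn addnS addnACA addnA.
(* The position 0 may be included in the count, as a < a is false. *)
have -> : nat_of_ord a = \sum_(j < n) (abs_perm w (lift ord0 j) < a).
  transitivity (\sum_(j < n.+1) (abs_perm w j < a)); last by rewrite big_ord_recl ltnn.
  transitivity (\sum_(j < n.+1) (j < a));
    last by rewrite [LHS](reindex_inj (@perm_inj _ (abs_perm w))).
  rewrite -[LHS]card_ord -sum1_card (big_ord_widen n.+1 (fun=> 1));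
    last exact: ltnW (ltn_ord a).
  by rewrite big_mkcond; apply: eq_bigr => i _; case: ltnP.
rewrite -big_split; apply: eq_bigr => j _ /=.
have := absz_value w (lift ord0 j); have := absz_value w ord0; rewrite -/a.
have : value w (lift ord0 j) != value w ord0 by apply: value_neq.
have : abs_perm w (lift ord0 j) != a by rewrite (inj_eq perm_inj).
rewrite -val_eqE /=.
move: (value w _) (value w _) pos => x y.
move: (nat_of_ord (abs_perm w _)) (nat_of_ord a) => b c.
by lia.
Qed.

Section TypeB.
Variable n : nat.
Implicit Types (w u : sperm n) (s : 'S_n).

Lemma sperm_of_tpermV (i j : 'I_n) : ((sperm_of (tperm i j))^-1 = sperm_of (tperm i j))%g.
Proof. by apply/eqP; rewrite eq_invg_mul -[X in (X * _)%g]mul1g sperm_of_tpermK. Qed.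

Lemma flipV (k : 'I_n) : ((flip k)^-1 = flip k)%g.
Proof. by apply/eqP; rewrite eq_invg_mul -[X in (X * _)%g]mul1g flipK. Qed.

Lemma sperm_of1 : sperm_of 1%g = 1%g :> sperm n.
Proof. by apply: value_inj => i; rewrite value_sperm_of value1 perm1. Qed.

Lemma sperm_ofM (s t : 'S_n) : (sperm_of s * sperm_of t = sperm_of (t * s))%g.
Proof. by apply: value_inj => i; rewrite valueM_sperm_of !value_sperm_of permM. Qed.

Lemma sperm_of_injective : injective (@sperm_of n).
Proof.
move=> s t E; apply/permP => i; apply/val_inj.
by have := congr1 (fun w => value w i) E; rewrite /= !value_sperm_of => -[].
Qed.

Lemma unsigned_group_set : group_set (@sperm_of n @: setT).
Proof.
apply/group_setP; split=> [|_ _ /imsetP[s _ ->] /imsetP[t _ ->]].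
  by rewrite -sperm_of1 imset_f.
by rewrite sperm_ofM imset_f.
Qed.

(** The parabolic subgroup generated by gensA (coxlenA). *)
Definition unsigned := Group unsigned_group_set.

Lemma unsignedP w : w \in unsigned -> exists s, w = sperm_of s.
Proof. by case/imsetP => s _ ->; exists s. Qed.

Lemma gensA_unsigned : gensA n \subset unsigned.
Proof. by apply/subsetP => w /mem_gensA[i [j [_ ->]]]; apply: imset_f. Qed.

Lemma value1_increasing (i j : 'I_n) : i < j -> (value 1%g i < value 1%g j)%R.
Proof. by rewrite !value1 ltz_nat ltnS. Qed.

Lemma lengthB1 : lengthB (1%g : sperm n) = 0.
Proof.
rewrite /lengthB /inversions increasing_weighted_inv //; last exact: value1_increasing.
by rewrite -sperm_of1 negsum_sperm_of.
Qed.

Lemma lengthB_step_gensA w u : u \in gensA n ->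
  lengthB (w * u)%g = (lengthB w).+1 \/ (lengthB (w * u)%g).+1 = lengthB w.
Proof.
case/mem_gensA => i [j [ji ->]].
case: (adjacent_cases w ji) => [/(lengthB_adjacent ji)|/(lengthB_adjacent_desc ji)].
  by left.
by right.
Qed.

Lemma gensA_descent w :
  (exists2 s, s \in gensA n & lengthB (w * s^-1)%g < lengthB w) \/
  (forall i j : 'I_n, i < j -> (value w i < value w j)%R).
Proof.
have [inc|] := boolP [forall i : 'I_n, forall j : 'I_n,
                       (j == i.+1 :> nat) ==> (value w i < value w j)%R].
  right; apply: adjacent_increasing => i j /eqP ji.
  by apply: (implyP (forallP (forallP inc i) j)).
case/forallPn => i /forallPn[j]; rewrite negb_imply => /andP[/eqP ji ngt]; left.
exists (sperm_of (tperm i j)); first exact: gensA_adjacent.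
rewrite sperm_of_tpermV -(@lengthB_adjacent_desc _ w i j) //.
by case: (adjacent_cases w ji) => // ij; rewrite ij in ngt.
Qed.

Lemma coxlenA : <<gensA n>>%g = unsigned /\ {in unsigned, coxlen (gensA n) =1 @lengthB n}.
Proof.
apply: coxlen_descent => [|||w /unsignedP[s ->] s1].
- exact: gensA_unsigned.
- exact: lengthB1.
- by move=> w s _ /(lengthB_step_gensA w)[->|<-] //; rewrite ltnW // ltnW.
case: (gensA_descent (sperm_of s)) => // inc; case/eqP: s1.
by apply: positive_increasing1 => // i; rewrite value_sperm_of.
Qed.

(** An adjacent ascent could be exchanged to lengthen w0. *)
Lemma longest_decreasing (G : {group sperm n}) S w0 : gensA n \subset G ->
   {in G, coxlen S =1 @lengthB n} -> longest G S w0 ->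
   forall i j : 'I_n, i < j -> (value w0 j < value w0 i)%R.
Proof.
move=> sAG lenE [Gw0 max_w0] i j ij; rewrite -ltrN2.
apply: (@adjacent_increasing _ (fun i => - value w0 i)%R) => // {ij}i {}j ji; rewrite ltrN2.
case: (adjacent_cases w0 ji) => // /(lengthB_adjacent ji) longer.
have Gws : (w0 * sperm_of (tperm i j))%g \in G.
  by rewrite groupM // (subsetP sAG) // gensA_adjacent.
by have := max_w0 _ Gws; rewrite !lenE // longer ltnn.
Qed.

Lemma majE w : maj w = major_index (value w).
Proof. by rewrite /maj seq_maj_map_enum. Qed.

Lemma nmajE w : nmaj w = (major_index (value w) + negsum (value w))%N.
Proof.
rewrite /nmaj /seq_nmaj seq_maj_map_enum PoszD; congr (_ + _)%R.
rewrite size_map size_enum_ord big_add1 /= big_mkord big_mkcond -sumrN /negsum.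
rewrite (big_morph Posz PoszD (erefl _)).
apply: eq_bigr => i _; rewrite (nth_map i) ?nth_ord_enum ?size_enum_ord // -/(value w i).
by case: ifP => [neg|_]; rewrite ?oppr0 // ltz0_abs.
Qed.

Lemma distribution_maj :
  distribution unsigned (@maj n) = distribution unsigned (fun w => (lengthB w)%:Z)%R.
Proof.
have shift s (i j : 'I_n) :
    (value (sperm_of s) j < value (sperm_of s) i = ((s j)%:Z < (s i)%:Z))%R.
  by rewrite !value_sperm_of !ltz_nat ltnS.
rewrite /distribution !big_imset /=; try by move=> s t _ _; apply: sperm_of_injective.
rewrite [LHS](eq_bigl xpredT) => [|s]; last exact: in_setT.
rewrite [RHS](eq_bigl xpredT) => [|s]; last exact: in_setT.
have := macmahon (tofrac 'X : {fraction {poly int}})%R n.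
congr (_ = _); apply: eq_bigr => s _.
  by rewrite majE -exprnP /major_index (eq_weighted_inv _ _ (shift s)).
by rewrite /lengthB negsum_sperm_of addn0 -exprnP /inversions (eq_weighted_inv _ _ (shift s)).
Qed.

Lemma length_class_maj : length_class <<gensA n>>%g (gensA n) (@maj n).
Proof.
have [genA lenA] := coxlenA; split.
- by rewrite genA distribution_maj; apply: eq_bigr => w Ww; rewrite lenA.
- rewrite majE /major_index increasing_weighted_inv //; last exact: value1_increasing.
  by move=> i j /eqP<-.
move=> w0; rewrite genA => lw0; have [Gw0 _] := lw0.
rewrite lenA // majE /lengthB.
rewrite (decreasing_major_index (longest_decreasing gensA_unsigned lenA lw0)).
by have [s ->] := unsignedP Gw0; rewrite negsum_sperm_of addn0.
Qed.

End TypeB.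

(** * Parabolic factorization of signed permutations *)

Section ParabolicFactorization.
Variable n : nat.
Implicit Types w u : sperm n.+1.

Local Notation upperB := (upper_part [set: sperm n.+1] (gensB n.+1) (gensA n.+1)).
Local Notation lowerB := (lower_part [set: sperm n.+1] (gensB n.+1) (gensA n.+1)).

Lemma gensBP w : w \in gensB n.+1 -> w = flip ord0 \/ w \in gensA n.+1.
Proof.
case/setUP => [/imsetP[i] | ]; last by right.
by rewrite inE => /eqP i0 ->; left; congr flip; apply: val_inj.
Qed.

Lemma flip_gensB : flip ord0 \in gensB n.+1.
Proof. by apply/setUP; left; apply/imsetP; exists ord0; rewrite ?inE. Qed.

Lemma lengthB_flip_desc w :
  (value w ord0 < 0)%R -> (lengthB (w * flip ord0)%g).+1 = lengthB w.
Proof.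
move=> neg; rewrite -[in RHS](flipK w ord0) [RHS]lengthB_flip //.
by rewrite valueM_flip eqxx oppr_gt0.
Qed.

Lemma value_neq0 w i : value w i != 0%R.
Proof. by rewrite -absz_eq0 absz_value. Qed.

(** If no generator lowers lengthB, then the window increases from a positive
    first entry, hence consists of 1, ..., n + 1 in this order. *)
Lemma coxlenB w : coxlen (gensB n.+1) w = lengthB w.
Proof.
suff [_ -> //] : <<gensB n.+1>>%g = [set: sperm n.+1]%G /\
  {in [set: sperm n.+1]%G, coxlen (gensB n.+1) =1 @lengthB n.+1} by rewrite inE.
apply: coxlen_descent => [|||{}w _ w1].
- exact: subsetT.
- exact: lengthB1.
- move=> {}w s _ /gensBP[->|/(lengthB_step_gensA w)[->|<-] //]; last by rewrite ltnW // ltnW.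
  have [neg|pos|/eqP] := ltgtP (value w ord0) 0%R; last by rewrite (negPf (value_neq0 _ _)).
    by rewrite -(lengthB_flip_desc neg) ltnW // ltnW.
  by rewrite lengthB_flip.
have [neg | pos] := ltP (value w ord0) 0%R.
  by exists (flip ord0); rewrite ?flip_gensB // flipV -(lengthB_flip_desc neg).
case: (gensA_descent w) => [[s sA ltL] | inc]; first by exists s; rewrite // in_setU sA orbT.
case/eqP: w1; apply: positive_increasing1 => // i.
have [->|i0] := eqVneq i ord0; first by rewrite lt_neqAle eq_sym value_neq0.
by apply: le_lt_trans pos (inc _ _ _); rewrite lt0n.
Qed.

(** The window of u is increasing, since an adjacent descent would shorten u; so
    w i = u (p i) has the relative order of p i. Moreover p only permutes the
    entries of u, hence w and u have the same negsum, which is the length of u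
    because u has no inversion. *)
Lemma parabolic_factorization w :
    let u := upperB w in
    let p := lowerB w in
  [/\ p \in <<gensA n.+1>>%g,
      coxlen (gensB n.+1) u = negsum (value w),
      inversions (value w) = inversions (value p)
    & major_index (value w) = major_index (value p)].
Proof.
move=> u p; have [genA _] := coxlenA n.+1.
have [uW pJ] : u \in min_coset_reps [set: sperm n.+1] (gensB n.+1) (gensA n.+1) /\
               p \in <<gensA n.+1>>%g.
  apply: (@factorizationP _ [set: sperm n.+1]%G) => [|v s _ sA|]; rewrite ?subsetT ?inE //.
  rewrite !coxlenB; case: (lengthB_step_gensA v sA) => [->|<-].
    by rewrite neq_ltn ltnSn orbT.
  by rewrite neq_ltn ltnSn.
have inc : forall i j : 'I_n.+1, i < j -> (value u i < value u j)%R.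
  apply: adjacent_increasing => i j ji; case: (adjacent_cases u ji) => //.
  move=> /(lengthB_adjacent_desc ji) desc.
  move: uW; rewrite inE => /andP[_ /forall_inP/(_ _ (gensA_adjacent ji))].
  by rewrite !coxlenB -/u -desc ltnNge leqnSn.
have [s ps] : exists s, p = sperm_of s by apply: unsignedP; rewrite -genA.
have wE : w = (u * sperm_of s)%g by rewrite -ps mulKVg.
have order i j : (value w j < value w i = (value p j < value p i))%R.
  rewrite wE ps !valueM_sperm_of !value_sperm_of ltz_nat ltnS.
  case: (ltngtP (s j) (s i)) => [/inc->//|/inc/ltW|/ord_inj->]; last by rewrite ltxx.
  by rewrite leNgt => /negPf.
split=> //; try by apply: eq_weighted_inv.
rewrite coxlenB /lengthB /inversions increasing_weighted_inv // add0n.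
by rewrite wE negsumM_sperm_of.
Qed.

Lemma nmaj_induced w :
  nmaj w = ((coxlen (gensB n.+1) (upperB w))%:Z + maj (lowerB w))%R.
Proof.
have [_ -> _ E] := parabolic_factorization w.
by rewrite nmajE majE E PoszD addrC.
Qed.

Lemma coxlen_parabolic w :
  ((coxlen (gensB n.+1) w)%:Z =
     (coxlen (gensB n.+1) (upperB w))%:Z + (coxlen (gensA n.+1) (lowerB w))%:Z)%R.
Proof.
have [pJ -> E _] := parabolic_factorization w; have [genA lenA] := coxlenA n.+1.
rewrite genA in pJ; rewrite coxlenB lenA // {1}/lengthB E -PoszD addnC /lengthB.
by have [s ->] := unsignedP pJ; rewrite negsum_sperm_of addn0.
Qed.

Lemma length_class_nmaj : length_class [set: sperm n.+1] (gensB n.+1) (@nmaj n.+1).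
Proof.
split.
- apply: (@eq_distribution_cosets _ [set: sperm n.+1]%G (gensB n.+1) (gensA n.+1)
    (fun u => (coxlen (gensB n.+1) u)%:Z)%R _ _ (@maj n.+1)
    (fun p => (coxlen (gensA n.+1) p)%:Z)%R) => [|w _|w _|w _|].
  + exact: subsetT.
  + by case: (parabolic_factorization w).
  + exact: nmaj_induced.
  + exact: coxlen_parabolic.
  by case: (length_class_maj n.+1).
- have := lengthB1 n.+1; rewrite /lengthB nmajE => /eqP.
  rewrite addn_eq0 => /andP[_ /eqP->]; rewrite /major_index increasing_weighted_inv //.
    by move=> i j /eqP<-.
  exact: value1_increasing.
move=> w0 lw0; rewrite coxlenB nmajE decreasing_major_index //.
apply: (@longest_decreasing _ [set: sperm n.+1]%G _ _ _ _ lw0) => [|w _]; first exact: subsetT.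
exact: coxlenB.
Qed.

End ParabolicFactorization.

Theorem proposition5p1 (n : nat) (hn : (2 <= n)%N) :
  induced_by [set: sperm n] (gensB n) (gensA n) (@nmaj n) (@maj n).
Proof.
case: n hn => // n _; split=> [||w _].
- exact: length_class_nmaj.
- exact: length_class_maj.
exact: nmaj_induced.
Qed.
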